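(* Let $A$ be a finite-dimensional unital algebra over $\mathbb C$ with a coproduct $\Delta$ that admits a counit. Let $\varphi$ be a faithful left integral on $A$, with an associated linear map $S:A\to A$. Then $S$ is uniquely determined by $\varphi$, it is injective, and it flips the coproduct, i.e. $\Delta(S(a))=\zeta((S\otimes S)\Delta(a))$ for all $a\in A$, where $\zeta(x\otimes y)=y\otimes x$. Similarly, if $\psi$ is a faithful right integral on $A$ with an associated linear map $S':A\to A$, then $S'$ is uniquely determined by $\psi$, injective, and flips the coproduct.
   Context: A coproduct on $A$ is a linear map $\Delta:A\to A\otimes A$ with $(\Delta\otimes\iota)\Delta=(\iota\otimes\Delta)\Delta$ (not assumed multiplicative or unital); $\iota$ is the identity map. A counit is a linear map $\varepsilon:A\to\mathbb C$ with $(\varepsilon\otimes\iota)\Delta(a)=a=(\iota\otimes\varepsilon)\Delta(a)$ for all $a$. A linear functional $\omega$ on $A$ is faithful if $\omega(ac)=0$ for all $c$ implies $a=0$, and $\omega(ac)=0$ for all $a$ implies $c=0$. A linear functional $\varphi$ on $A$ is a left integral if there is a linear map $S:A\to A$ (an associated map) with $S((\iota\otimes\varphi)(\Delta(a)(1\otimes c)))=(\iota\otimes\varphi)((1\otimes a)\Delta(c))$ for all $a,c\in A$. A linear functional $\psi$ is a right integral if there is a linear map $S':A\to A$ (an associated map) with $S'((\psi\otimes\iota)((c\otimes 1)\Delta(a)))=(\psi\otimes\iota)(\Delta(c)(a\otimes 1))$ for all $a,c\in A$. *)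

(* Defs.v *)
From HB Require Import structures.
From mathcomp Require Import all_boot all_order all_algebra all_field.
From mathcomp Require Import reals complex.

Set Implicit Arguments.
Unset Strict Implicit.
Unset Printing Implicit Defensive.

Import GRing.Theory VectorInternalTheory.
Local Open Scope ring_scope.

(* MathComp has no tensor product of vector spaces. For finite-dimensional U
   and V we take the space of coordinate matrices in the bases of U and V given
   by v2r; u (x) v is the rank-one matrix with entries u_i * v_j. The lemmas
   tlift_tens and tensor_ext below are the universal property (existence and
   uniqueness of the linear map induced by a bilinear one). Every map out of a
   tensor product is then defined by tlift from its values on pure tensors. *)

Section Tensor.
Variable K : fieldType.
Implicit Types U V W : vectType K.

Definition tensor U V : vectType K := 'M[K]_(dim U, dim V).

Definition tens U V (u : U) (v : V) : tensor U V := (v2r u)^T *m v2r v.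

Definition vbase U (i : 'I_(dim U)) : U := r2v (delta_mx 0 i).

Definition tlift U V W (f : U -> V -> W) (t : tensor U V) : W :=
  \sum_i \sum_j (t : 'M[K]_(_, _)) i j *: f (vbase i) (vbase j).

Lemma tens_linearl U V (v : V) : linear (fun u : U => tens u v).
Proof.
by move=> k u1 u2; rewrite /tens linearP /= linearP /= mulmxDl -scalemxAl.
Qed.

Lemma tens_linearr U V (u : U) : linear (fun v : V => tens u v).
Proof. by move=> k v1 v2; rewrite /tens linearP /= mulmxDr -scalemxAr. Qed.

Lemma tlift_is_linear U V W (f : U -> V -> W) : linear (tlift f).
Proof.
move=> k s t; rewrite /tlift scaler_sumr -big_split /=; apply: eq_bigr => i _.
rewrite scaler_sumr -big_split /=; apply: eq_bigr => j _.
by rewrite !mxE scalerDl scalerA.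
Qed.

HB.instance Definition _ U V W (f : U -> V -> W) :=
  GRing.isLinear.Build K (tensor U V) W _ (tlift f) (tlift_is_linear f).

Lemma vbase_sum U (u : U) : u = \sum_i v2r u 0 i *: vbase i.
Proof.
rewrite -[LHS]v2rK [in LHS](row_sum_delta (v2r u)) linear_sum /=.
by apply: eq_bigr => i _; rewrite linearZ.
Qed.

Lemma tlift_tens U V W (f : U -> V -> W) (u : U) (v : V) :
  (forall y, linear (f^~ y)) -> (forall x, linear (f x)) ->
  tlift f (tens u v) = f u v.
Proof.
move=> fl fr; rewrite /tlift.
pose gl y : {linear U -> W} :=
  HB.pack (f^~ y) (GRing.isLinear.Build K U W _ (f^~ y) (fl y)).
pose gr x : {linear V -> W} :=
  HB.pack (f x) (GRing.isLinear.Build K V W _ (f x) (fr x)).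
rewrite [in RHS](vbase_sum u) -[RHS]/(gl v _) linear_sum /=.
apply: eq_bigr => i _; rewrite -[RHS]/(gl v _) linearZ /=.
rewrite [in RHS](vbase_sum v) -[f _ _]/(gr _ _) linear_sum /= scaler_sumr.
apply: eq_bigr => j _; rewrite -[f _ _ in RHS]/(gr _ _) linearZ /= scalerA.
by rewrite /tens !mxE big_ord1 !mxE.
Qed.

Lemma tensor_sum U V (t : tensor U V) :
  t = \sum_i \sum_j (t : 'M[K]_(_, _)) i j *: tens (vbase i) (vbase j).
Proof.
rewrite [LHS](matrix_sum_delta t); apply: eq_bigr => i _; apply: eq_bigr => j _.
by rewrite /tens /vbase !r2vK trmx_delta mul_delta_mx.
Qed.

Lemma tensor_ext U V W (f g : {linear tensor U V -> W}) :
  (forall u v, f (tens u v) = g (tens u v)) -> f =1 g.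
Proof.
move=> fg t; rewrite (tensor_sum t) !linear_sum; apply: eq_bigr => i _.
by rewrite !linear_sum; apply: eq_bigr => j _; rewrite !linearZ fg.
Qed.

Definition tmap U V U' V' (f : U -> U') (g : V -> V') :
    tensor U V -> tensor U' V' :=
  tlift (fun u v => tens (f u) (g v)).

Definition tflip U V : tensor U V -> tensor V U := tlift (fun u v => tens v u).

Definition tassoc U V W : tensor (tensor U V) W -> tensor U (tensor V W) :=
  tlift (fun t w => tlift (fun u v => tens u (tens v w)) t).

(* (f (x) iota) and (iota (x) f), with K (x) V and V (x) K identified with V *)
Definition slicel U V (f : U -> K) : tensor U V -> V :=
  tlift (fun u v => f u *: v).
Definition slicer U V (f : V -> K) : tensor U V -> U :=
  tlift (fun u v => f v *: u).

Lemma tmap_tens U V U' V' (f : {linear U -> U'}) (g : {linear V -> V'}) u v :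
  tmap f g (tens u v) = tens (f u) (g v).
Proof.
by apply: tlift_tens => x k y z; rewrite linearP (tens_linearl, tens_linearr).
Qed.

Lemma tflip_tens U V (u : U) (v : V) : tflip (tens u v) = tens v u.
Proof. by apply: tlift_tens => x k y z; rewrite (tens_linearl, tens_linearr). Qed.

Lemma tassoc_tens U V W (u : U) (v : V) (w : W) :
  tassoc (tens (tens u v) w) = tens u (tens v w).
Proof.
rewrite /tassoc tlift_tens => [|x|t k y z].
- by apply: tlift_tens => x k y z; rewrite !(tens_linearl, tens_linearr).
- exact: tlift_is_linear.
rewrite /tlift scaler_sumr -big_split /=; apply: eq_bigr => i _.
rewrite scaler_sumr -big_split /=; apply: eq_bigr => j _.
by rewrite !tens_linearr scalerDr !scalerA mulrC.
Qed.

Lemma slicel_tens U V (f : {scalar U}) (u : U) (v : V) :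
  slicel f (tens u v) = f u *: v.
Proof.
apply: tlift_tens => x k y z; last by rewrite scalerDr !scalerA mulrC.
by rewrite linearP scalerDl scalerA.
Qed.

Lemma slicer_tens U V (f : {scalar V}) (u : U) (v : V) :
  slicer f (tens u v) = f v *: u.
Proof.
apply: tlift_tens => x k y z; first by rewrite scalerDr !scalerA mulrC.
by rewrite linearP scalerDl scalerA.
Qed.

End Tensor.

Section Coproduct.
Variables (K : fieldType) (A : falgType K).

Definition tmul (s t : tensor A A) : tensor A A :=
  tlift (fun a b => tlift (fun c d => tens (a * c) (b * d)) t) s.

Lemma tmul_tens (a b c d : A) :
  tmul (tens a b) (tens c d) = tens (a * c) (b * d).
Proof.
rewrite /tmul tlift_tens => [|y k x1 x2|x k y1 y2].
- apply: tlift_tens => x k y z.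
    by rewrite mulrDr -scalerAr tens_linearl.
  by rewrite mulrDr -scalerAr tens_linearr.
- rewrite /tlift scaler_sumr -big_split /=; apply: eq_bigr => i _.
  rewrite scaler_sumr -big_split /=; apply: eq_bigr => j _.
  by rewrite mulrDl -scalerAl tens_linearl scalerDr !scalerA mulrC.
rewrite /tlift scaler_sumr -big_split /=; apply: eq_bigr => i _.
rewrite scaler_sumr -big_split /=; apply: eq_bigr => j _.
by rewrite mulrDl -scalerAl tens_linearr scalerDr !scalerA mulrC.
Qed.

Definition coassociative (Delta : {linear A -> tensor A A}) : Prop :=
  forall a, tassoc (tmap Delta idfun (Delta a)) = tmap idfun Delta (Delta a).

Definition is_counit (Delta : {linear A -> tensor A A}) (eps : {scalar A}) :
    Prop :=
  forall a, slicel eps (Delta a) = a /\ slicer eps (Delta a) = a.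

Definition faithful (omega : {scalar A}) : Prop :=
  (forall a, (forall c, omega (a * c) = 0) -> a = 0) /\
  (forall c, (forall a, omega (a * c) = 0) -> c = 0).

Definition left_associated (Delta : {linear A -> tensor A A})
    (phi : {scalar A}) (S : {linear A -> A}) : Prop :=
  forall a c, S (slicer phi (tmul (Delta a) (tens 1 c))) =
              slicer phi (tmul (tens 1 a) (Delta c)).

Definition left_integral (Delta : {linear A -> tensor A A})
    (phi : {scalar A}) : Prop :=
  exists S : {linear A -> A}, left_associated Delta phi S.

Definition right_associated (Delta : {linear A -> tensor A A})
    (psi : {scalar A}) (S' : {linear A -> A}) : Prop :=
  forall a c, S' (slicel psi (tmul (tens c 1) (Delta a))) =
              slicel psi (tmul (Delta c) (tens a 1)).

Definition right_integral (Delta : {linear A -> tensor A A})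
    (psi : {scalar A}) : Prop :=
  exists S' : {linear A -> A}, right_associated Delta psi S'.

Definition flips_coproduct (Delta : {linear A -> tensor A A})
    (S : {linear A -> A}) : Prop :=
  forall a, Delta (S a) = tflip (tmap S S (Delta a)).

End Coproduct.

(* Main.v *)
(* Write [D a = a1 (x) a2] and let [B] be a nondegenerate bilinear form with
   [S (a1 B(a2, c)) = c1 B(a, c2)].  Representing the counit as [B(-, f)] gives
   [S a = f1 B(a, f2)], whence uniqueness; representing it as [B(g, -)] gives
   [S (g1 B(g2, c)) = c], so [S] is onto, hence injective.  Finally
     [D (S a) = f1 (x) f2 B(a, f3) = f1 (x) S (a1 B(a2, f2))
              = f1 B(a2, f2) (x) S a1 = S a2 (x) S a1].
   A left integral is the case [B(a, c) = phi (a c)]; a right integral is the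
   case [B(a, c) = psi (c a)] for the flipped coproduct. *)
From HB Require Import structures.
Require Import Defs.
From mathcomp Require Import all_boot all_order all_algebra all_field.
From mathcomp Require Import reals complex.
Import GRing.Theory VectorInternalTheory.
Local Open Scope ring_scope.

(** * Endomorphisms of a finite-dimensional space *)

Section Endomorphisms.
Set Implicit Arguments.
Unset Strict Implicit.
Variables (K : fieldType) (V : vectType K).

Lemma linear_inj_surj (f : {linear V -> V}) :
  injective f -> forall y, exists x, f x = y.
Proof.
move=> finj y.
have kerf : lker (linfun f) == 0%VS.
  by apply/lker0P => u v; rewrite !lfunE; apply: finj.
have : y \in limg (linfun f) by rewrite (lker0_limgf kerf) memvf.
by case/memv_imgP=> x _ ->; exists x; rewrite lfunE.
Qed.

Lemma linear_surj_inj (f : {linear V -> V}) :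
  (forall y, exists x, f x = y) -> injective f.
Proof.
move=> fsurj.
have limgf : limg (linfun f) = fullv.
  apply/eqP; rewrite eqEsubv subvf; apply/subvP => y _.
  by have [x <-] := fsurj y; rewrite -(lfunE f) memv_img ?memvf.
have /lker0P kerf : lker (linfun f) == 0%VS.
  rewrite -dimv_eq0; have := limg_ker_dim (linfun f) fullv.
  by rewrite limgf capfv => /(canRL (addnK _)); rewrite subnn => ->.
by move=> u v fuv; apply: kerf; rewrite !lfunE.
Qed.

End Endomorphisms.

(** * Calculus of induced maps on tensor products *)

Section Lift.
Set Implicit Arguments.
Unset Strict Implicit.
Variable K : fieldType.
Implicit Types U V W X : vectType K.

Lemma eq_tlift U V W (F G : U -> V -> W) (t : tensor U V) :
  (forall u v, F u v = G u v) -> tlift F t = tlift G t.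
Proof.
by move=> FG; apply: eq_bigr => i _; apply: eq_bigr => j _; rewrite FG.
Qed.

Lemma linear_tlift U V W X (g : {linear W -> X}) (F : U -> V -> W) t :
  g (tlift F t) = tlift (fun u v => g (F u v)) t.
Proof.
rewrite linear_sum; apply: eq_bigr => i _.
by rewrite linear_sum; apply: eq_bigr => j _; rewrite linearZ.
Qed.

Lemma tlift_linear U V W X (F : X -> U -> V -> W) (t : tensor U V) :
  (forall u v, linear (fun x => F x u v)) -> linear (fun x => tlift (F x) t).
Proof.
move=> Flin k x y; rewrite /tlift scaler_sumr -big_split /=.
apply: eq_bigr => i _; rewrite scaler_sumr -big_split /=; apply: eq_bigr => j _.
by rewrite Flin scalerDr !scalerA mulrC.
Qed.

(** With one index per tensor, exchanging two tensors is a single swap of sums. *)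
Lemma tlift_pair U V W (F : U -> V -> W) (t : tensor U V) :
  tlift F t = \sum_p (t : 'M[K]_(_, _)) p.1 p.2 *: F (vbase p.1) (vbase p.2).
Proof. exact: pair_big. Qed.

Lemma exchange_tlift U V U' V' W (F : U -> V -> U' -> V' -> W) s t :
  tlift (fun u v => tlift (F u v) t) s =
  tlift (fun u' v' => tlift (fun u v => F u v u' v') s) t.
Proof.
rewrite !tlift_pair.
under eq_bigr do rewrite tlift_pair scaler_sumr.
under [RHS]eq_bigr do rewrite tlift_pair scaler_sumr.
rewrite exchange_big; apply: eq_bigr => p _; apply: eq_bigr => q _.
by rewrite !scalerA mulrC.
Qed.

(** [tlift] evaluates [F] at basis vectors only, whereas [f u] and [g v] are arbitrary; bilinearity
    of [F] bridges the gap. *)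
Lemma tlift_tmap U V U' V' W (f : U -> U') (g : V -> V') (F : U' -> V' -> W) t :
  (forall v, linear (F^~ v)) -> (forall u, linear (F u)) ->
  tlift F (tmap f g t) = tlift (fun u v => F (f u) (g v)) t.
Proof.
move=> Fl Fr; rewrite linear_tlift; apply: eq_tlift => u v.
exact: tlift_tens.
Qed.

Lemma tlift_tflip U V W (F : V -> U -> W) (t : tensor U V) :
  (forall u, linear (F^~ u)) -> (forall v, linear (F v)) ->
  tlift F (tflip t) = tlift (fun u v => F v u) t.
Proof.
move=> Fl Fr; rewrite linear_tlift; apply: eq_tlift => u v.
exact: tlift_tens.
Qed.

Lemma tflipK U V : cancel (@tflip K U V) (@tflip K V U).
Proof.
move=> t; rewrite [LHS]tlift_tflip; last 2 first.
- by move=> u; apply: tens_linearr.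
- by move=> v; apply: tens_linearl.
by rewrite [RHS]tensor_sum.
Qed.

(** Linearity of [tassoc] and [tflip] lets [linear_tlift] push them inside a sum and makes
    [tflip \o D] a [{linear}] map. *)
HB.instance Definition _ U V W := GRing.Linear.copy (@tassoc K U V W)
  (tlift (fun (t : tensor U V) (w : W) =>
    tlift (fun u v => tens u (tens v w)) t)).

HB.instance Definition _ U V := GRing.Linear.copy (@tflip K U V)
  (tlift (fun (u : U) (v : V) => tens v u)).

End Lift.

(** * Coassociativity in Sweedler form and maps associated with a nondegenerate form *)

Section Sweedler.
Set Implicit Arguments.
Unset Strict Implicit.
Variables (K : fieldType) (A : vectType K).
Implicit Type D : {linear A -> tensor A A}.

Definition trilinear (W : vectType K) (F : A -> A -> A -> W) : Prop :=
  [/\ forall y z, linear (fun x => F x y z),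
      forall x z, linear (fun y => F x y z)
    & forall x y, linear (F x y)].

(** Coassociativity tested against every trilinear map: the formal version of writing [a1], [a2],
    [a3] without regard to bracketing, with no associator left. *)
Definition sweedler_coassoc D : Prop :=
  forall (W : vectType K) (F : A -> A -> A -> W) (a : A), trilinear F ->
  tlift (fun x z => tlift (fun u v => F u v z) (D x)) (D a) =
  tlift (fun x z => tlift (F x) (D z)) (D a).

Lemma sweedler_coassoc_flip D :
  sweedler_coassoc D -> sweedler_coassoc (@tflip K A A \o D).
Proof.
move=> coD W F a [F1 F2 F3] /=.
have F12 z : (forall v, linear (fun u => F u v z)) /\
             (forall u, linear (fun v => F u v z)) by split.
rewrite tlift_tflip; last 2 first.
- by move=> z k x y /=; rewrite !linearP.
- by move=> x; apply: tlift_linear.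
rewrite tlift_tflip; last 2 first.
- by move=> z; apply: tlift_linear.
- by move=> x k y z /=; rewrite !linearP.
under eq_tlift => x z do rewrite tlift_tflip //.
under [RHS]eq_tlift => x z do rewrite tlift_tflip //.
(* Reversing the three arguments turns each side of the flipped identity into the opposite side of
   the original one. *)
by rewrite (coD _ (fun x u v => F v u x)).
Qed.

(** Nondegeneracy makes [c |-> B(-, c)] an injection of [A] into its dual; equal dimensions make it
    onto. *)
Lemma scalar_repr (B : A -> A -> K) (f : {scalar A}) :
  (forall c, scalar (B^~ c)) -> (forall a, scalar (B a)) ->
  (forall c, (forall a, B a c = 0) -> c = 0) ->
  exists c, forall a, f a = B a c.
Proof.
move=> Bl Br B0.
pose bl c : {scalar A} :=
  HB.pack (B^~ c) (GRing.isLinear.Build K A K _ (B^~ c) (Bl c)).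
(* The functional [B(-, c)] is stored in [A] through its values on the basis, so that the map to the
   dual becomes an endomorphism of [A]. *)
pose coord c := r2v (\row_i B (vbase i) c) : A.
have coord_lin : linear coord.
  move=> k x y; rewrite /coord -linearP; congr r2v.
  by apply/rowP => i; rewrite !mxE Br.
pose g : {linear A -> A} :=
  HB.pack coord (GRing.isLinear.Build K A A _ coord coord_lin).
have Bg c a : B a c = \sum_i v2r a 0 i * v2r (g c) 0 i.
  rewrite [in LHS](vbase_sum a) -[LHS]/(bl c _) linear_sum.
  by apply: eq_bigr => i _; rewrite linearZ /= /coord r2vK mxE.
have ginj : injective g.
  move=> x y gxy; apply/eqP; rewrite -subr_eq0; apply/eqP/B0 => a.
  by rewrite Bg linearB gxy subrr linear0 big1 // => i _; rewrite mxE mulr0.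
have [c gc] := linear_inj_surj ginj (r2v (\row_i f (vbase i))).
exists c => a; rewrite Bg gc r2vK [in LHS](vbase_sum a) linear_sum.
by apply: eq_bigr => i _; rewrite linearZ mxE.
Qed.

Definition form_associated D (B : A -> A -> K) (S : {linear A -> A}) : Prop :=
  forall a c, S (tlift (fun x y => B y c *: x) (D a)) =
              tlift (fun x y => B a y *: x) (D c).

Lemma form_associatedP D (B : A -> A -> K) (eps : {scalar A})
    (S : {linear A -> A}) :
  sweedler_coassoc D ->
  (forall a, tlift (fun x y => eps y *: x) (D a) = a) ->
  (forall c, scalar (B^~ c)) -> (forall a, scalar (B a)) ->
  (forall a, (forall c, B a c = 0) -> a = 0) ->
  (forall c, (forall a, B a c = 0) -> c = 0) ->
  form_associated D B S ->
  [/\ forall T, form_associated D B T -> T =1 S, injective S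
    & forall a, D (S a) = tflip (tmap S S (D a))].
Proof.
move=> coD counit Bl Br B0l B0r SE.
have [f fE] := scalar_repr eps Bl Br B0r.
(* The same representation for the transposed form: [eps] is [B(g, -)]. *)
have [g gE] := scalar_repr eps Br Bl B0l.
have Lf a : tlift (fun x y => B y f *: x) (D a) = a.
  by rewrite -[RHS]counit; apply: eq_tlift => x y; rewrite fE.
split=> [T TE a||a].
(* By [Lf], every [a] is an argument at which the defining identity, taken at [c = f], prescribes
   the value. *)
- by rewrite -[in LHS](Lf a) -[in RHS](Lf a) TE SE.
- apply: linear_surj_inj => c.
  (* The identity at [a = g] sends this element to [c1 B(g, c2) = c1 eps(c2) = c]. *)
  exists (tlift (fun x y => B y c *: x) (D g)); rewrite SE -[RHS]counit.
  by apply: eq_tlift => x y; rewrite gE.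
have Sf b : S b = tlift (fun x y => B b y *: x) (D f) by rewrite -SE Lf.
have tensl_tlift (v : A) (F : A -> A -> A) t :
    tens (tlift F t) v = tlift (fun x y => tens (F x y) v) t.
  pose h : {linear A -> tensor A A} := HB.pack (fun u => tens u v)
    (GRing.isLinear.Build K A (tensor A A) _ _ (tens_linearl v)).
  exact: (linear_tlift h).
have tensr_tlift (u : A) (F : A -> A -> A) t :
    tens u (tlift F t) = tlift (fun x y => tens u (F x y)) t.
  pose h : {linear A -> tensor A A} := HB.pack (tens u)
    (GRing.isLinear.Build K A (tensor A A) _ _ (tens_linearr u)).
  exact: (linear_tlift h).
have tensZl k (u v : A) : tens (k *: u) v = k *: tens u v.
  by rewrite /tens linearZ /= linearZ /= -scalemxAl.
have tensZr k (u v : A) : tens u (k *: v) = k *: tens u v.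
  by rewrite /tens linearZ /= -scalemxAr.
(* Apply [D] to [S a = f1 B(a, f2)]; it acts on the first leg of [D f], and coassociativity then
   moves the splitting to the second leg. *)
transitivity (tlift (fun x z =>
    tlift (fun u v => B a z *: tens u v) (D x)) (D f)).
  rewrite Sf linear_tlift; apply: eq_tlift => x z.
  rewrite linearZ /= [in LHS](tensor_sum (D x)) -/(tlift _ _).
  exact: (linear_tlift (GRing.scale (B a z))).
rewrite (coD _ (fun u v z => B a z *: tens u v)); last first.
  split=> [v z|u z|u v] k x y.
  - by rewrite tens_linearl scalerDr !scalerA mulrC.
  - by rewrite tens_linearr scalerDr !scalerA mulrC.
  - by rewrite Br scalerDl scalerA.
(* The defining identity is read backwards at [c = z], the second leg of [D f]:
   [z1 B(a, z2) = S (a1 B(a2, z))]. *)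
transitivity (tlift (fun x z =>
    tlift (fun u v => B v z *: tens x (S u)) (D a)) (D f)).
  apply: eq_tlift => x z.
  transitivity (tens x (S (tlift (fun u v => B v z *: u) (D a)))).
    by rewrite SE tensr_tlift; apply: eq_tlift => u v; rewrite tensZr.
  rewrite linear_tlift tensr_tlift; apply: eq_tlift => u v.
  by rewrite linearZ /= tensZr.
(* With the sum over [D f] innermost, [f1 B(a2, f2)] is recognised as [S a2] by [Sf]. *)
rewrite exchange_tlift [RHS](linear_tlift (@tflip K A A)).
apply: eq_tlift => u v.
rewrite [RHS]tflip_tens (Sf v) tensl_tlift; apply: eq_tlift => x y.
by rewrite tensZl.
Qed.

Lemma coassociative_sweedler D :
  (forall a, tassoc (tmap D idfun (D a)) = tmap idfun D (D a)) ->
  sweedler_coassoc D.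
Proof.
move=> coD W F a [F1 F2 F3].
(* [G] is the linear map induced by [F] on the triple tensor product; applying it to both sides of
   coassociativity gives the two iterated sums. *)
pose G := tlift (fun x s => tlift (F x) s) : tensor A (tensor A A) -> W.
have GE x s : G (tens x s) = tlift (F x) s.
  apply: tlift_tens => [t|y]; last exact: tlift_is_linear.
  exact: tlift_linear.
have tassocE (s : tensor A A) z :
    tassoc (tens s z) = tlift (fun u v => tens u (tens v z)) s.
  apply: tlift_tens => [w|t]; first exact: tlift_is_linear.
  by apply: tlift_linear => u v k w1 w2; rewrite !tens_linearr.
have GmapE (t : tensor A A) : G (tmap idfun D t) =
    tlift (fun x z => tlift (F x) (D z)) t.
  by apply: tlift_tmap => [u|x]; [apply: tlift_linear | apply: tlift_is_linear].
rewrite -GmapE -coD.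
transitivity (tlift (fun x z => G (tassoc (tens (D x) z))) (D a)); last first.
  by rewrite /tmap linear_tlift [RHS](linear_tlift (tlift _)).
apply: eq_tlift => x z; rewrite tassocE [RHS](linear_tlift (tlift _)).
by apply: eq_tlift => u v; rewrite [RHS]GE tlift_tens.
Qed.

End Sweedler.

(** * Translation of left and right integrals into forms *)

Section Integrals.
Set Implicit Arguments.
Unset Strict Implicit.
Variables (K : fieldType) (A : falgType K).

Lemma tmul_tensr (t : tensor A A) (c d : A) :
  tmul t (tens c d) = tlift (fun x y => tens (x * c) (y * d)) t.
Proof.
apply: eq_tlift => x y; apply: tlift_tens => z k u v.
  by rewrite mulrDr -scalerAr tens_linearl.
by rewrite mulrDr -scalerAr tens_linearr.
Qed.

Lemma tmul_tensl (t : tensor A A) (a b : A) :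
  tmul (tens a b) t = tlift (fun x y => tens (a * x) (b * y)) t.
Proof.
by apply: tlift_tens => z; apply: tlift_linear => u v k x y;
  rewrite mulrDl -scalerAl ?tens_linearl ?tens_linearr.
Qed.

Lemma slicer_tlift (phi : {scalar A}) (F : A -> A -> tensor A A) t :
  slicer phi (tlift F t) = tlift (fun x y => slicer phi (F x y)) t.
Proof. exact: linear_tlift. Qed.

Lemma slicel_tlift (phi : {scalar A}) (F : A -> A -> tensor A A) t :
  slicel phi (tlift F t) = tlift (fun x y => slicel phi (F x y)) t.
Proof. exact: linear_tlift. Qed.

Lemma left_associated_form (D : {linear A -> tensor A A}) phi S :
  left_associated D phi S <-> form_associated D (fun a c => phi (a * c)) S.
Proof.
suff E a c : (slicer phi (tmul (D a) (tens 1 c)) =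
      tlift (fun x y => phi (y * c) *: x) (D a)) /\
    (slicer phi (tmul (tens 1 a) (D c)) =
      tlift (fun x y => phi (a * y) *: x) (D c)).
  by split=> SE a c; have [L R] := E a c; have := SE a c; rewrite L R.
rewrite tmul_tensl tmul_tensr !slicer_tlift.
by split; apply: eq_tlift => x y; rewrite slicer_tens ?mulr1 ?mul1r.
Qed.

(** Converts the first-leg slices of a right integral into the second-leg slices used by
    [form_associated]. *)
Lemma tlift_scale_flip (f : A -> K) (t : tensor A A) : scalar f ->
  tlift (fun x y => f y *: x) (tflip t) = tlift (fun x y => f x *: y) t.
Proof.
move=> flin; apply: tlift_tflip => x k u v.
  by rewrite scalerDr !scalerA mulrC.
by rewrite flin scalerDl scalerA.
Qed.

(** Here [S] receives [a2 psi(c a1)] and returns [c2 psi(c1 a)]: flipping [D] restores the order of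
    the legs, and the product inside [psi] is reversed. *)
Lemma right_associated_form (D : {linear A -> tensor A A}) psi S :
  right_associated D psi S <->
  form_associated (@tflip K A A \o D) (fun a c => psi (c * a)) S.
Proof.
suff E a c : (slicel psi (tmul (tens c 1) (D a)) =
      tlift (fun x y => psi (c * y) *: x) (tflip (D a))) /\
    (slicel psi (tmul (D c) (tens a 1)) =
      tlift (fun x y => psi (y * a) *: x) (tflip (D c))).
  by split=> SE a c; have [L R] := E a c; have := SE a c; rewrite L R.
rewrite tlift_scale_flip => [|k x y]; last first.
  by rewrite mulrDr -scalerAr linearP.
rewrite tlift_scale_flip => [|k x y]; last first.
  by rewrite mulrDl -scalerAl linearP.
rewrite tmul_tensl tmul_tensr !slicel_tlift.
by split; apply: eq_tlift => x y; rewrite slicel_tens ?mulr1 ?mul1r.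
Qed.

Lemma tflip_tmap (S : {linear A -> A}) (t : tensor A A) :
  tflip (tmap S S (tflip t)) = tmap S S t.
Proof.
rewrite [LHS](linear_tlift (@tflip K A A)) [LHS]tlift_tflip; last 2 first.
- by move=> x k u v /=; rewrite !tflip_tens linearP tens_linearr.
- by move=> x k u v /=; rewrite !tflip_tens linearP tens_linearl.
by apply: eq_tlift => x y; rewrite [LHS]tflip_tens.
Qed.

(** [tflip] is an involution and commutes with [tmap S S], so flipping the opposite coproduct
    amounts to flipping [D]. *)
Lemma flips_coproduct_flip (D : {linear A -> tensor A A}) (S : {linear A -> A}) :
  (forall a, tflip (D (S a)) = tflip (tmap S S (tflip (D a)))) ->
  flips_coproduct D S.
Proof. by move=> flip a; rewrite -[LHS]tflipK flip tflip_tmap. Qed.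

End Integrals.

(** * Left and right integrals as two instances of the statement on forms *)

Theorem proposition2p6 (R : realType) (A : falgType (complex R))
    (Delta : {linear A -> tensor A A}) :
  coassociative Delta ->
  (exists eps : {scalar A}, is_counit Delta eps) ->
  (forall (phi : {scalar A}) (S : {linear A -> A}),
     faithful phi -> left_integral Delta phi -> left_associated Delta phi S ->
     (forall T : {linear A -> A}, left_associated Delta phi T -> T =1 S) /\
     injective S /\
     flips_coproduct Delta S) /\
  (forall (psi : {scalar A}) (S' : {linear A -> A}),
     faithful psi -> right_integral Delta psi ->
     right_associated Delta psi S' ->
     (forall T : {linear A -> A}, right_associated Delta psi T -> T =1 S') /\
     injective S' /\
     flips_coproduct Delta S').
Proof.
move=> /coassociative_sweedler coD [eps counit].
have mull (f : {scalar A}) c : scalar (fun a => f (a * c)).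
  by move=> k x y; rewrite mulrDl -scalerAl linearP.
have mulr (f : {scalar A}) a : scalar (fun c => f (a * c)).
  by move=> k x y; rewrite mulrDr -scalerAr linearP.
split=> [phi S|psi S] [faithl faithr] _.
  case/left_associated_form/(form_associatedP coD (fun a => (counit a).2)) => //.
  by move=> uniq inj flip; split=> // T /left_associated_form/uniq.
(* The right counit law of the flipped coproduct is the left counit law of [Delta]. *)
have counit' a :
    tlift (fun x y => eps y *: x) ((@tflip _ A A \o Delta) a) = a.
  by rewrite /= tlift_scale_flip; [exact: (counit a).1 | exact: linearP].
case/right_associated_form/(form_associatedP (sweedler_coassoc_flip coD) counit').
(* For [B(a, c) = psi (c a)] the two linearity conditions, and likewise the two halves of
   faithfulness, trade places. *)
- by move=> c; apply: mulr.
- by move=> a; apply: mull.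
- exact: faithr.
- exact: faithl.
move=> uniq inj flip; split=> [T /right_associated_form/uniq //|].
by split; [exact: inj | exact: (flips_coproduct_flip flip)].
Qed.
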